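(* (a) Let $G=T(G)\oplus F$ be an Abelian group, where $T(G)$ is the torsion part of $G$ and $F$ is torsion-free. Then $G$ is perspective if and only if $T(G)$ and $F$ are perspective. (b) Let $G=D(G)\oplus R$ be an Abelian group, where $D(G)$ is the divisible part of $G$ and $R$ is reduced. Then $G$ is perspective if and only if $D(G)$ and $R$ are perspective.
   Context: An Abelian group $G$ is called perspective if any two isomorphic direct summands of $G$ have a common direct complement: whenever $G=A\oplus H=B\oplus K$ with $A\cong B$, there exists a subgroup $C\le G$ with $G=A\oplus C=B\oplus C$. The divisible part $D(G)$ is the largest divisible subgroup of $G$; a group is reduced if its only divisible subgroup is $0$. *)

(* Defs.v *)
From HB Require Import structures.
From mathcomp Require Import all_boot all_algebra.
From mathcomp Require Import boolp classical_sets functions.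

Set Implicit Arguments.
Unset Strict Implicit.
Unset Printing Implicit Defensive.

Import GRing.Theory.
Local Open Scope ring_scope.
Local Open Scope classical_set_scope.

(* An abelian group is a [zmodType]; its subgroups, and the groups arising as
   direct summands, are [Prop]-valued subsets of it.  The notions below are
   relative to such a subset, so that they apply both to the whole group
   ([setT]) and to its subgroups regarded as groups. *)
Section AbelianGroups.
Context {G : zmodType}.
Implicit Types S A B C H K D R F : set G.

Definition subgroup S : Prop := zmod_closed [in S].

Definition direct_sum S A H : Prop :=
  [/\ subgroup A, subgroup H, [set a + h | a in A & h in H] = S
    & A `&` H = [set 0]].

(* Only the restriction of [f] to [A] matters: any isomorphism from [A] onto
   [B] extends to a function on [G]. *)
Definition isomorphic A B : Prop :=
  exists2 f : G -> G, {in A &, {morph f : x y / x + y}} & set_bij A B f.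

Definition perspective S : Prop :=
  forall A H B K, direct_sum S A H -> direct_sum S B K -> isomorphic A B ->
  exists C, direct_sum S A C /\ direct_sum S B C.

Definition torsion_part S : set G :=
  [set x | S x /\ exists2 n, (0 < n)%N & x *+ n = 0].

Definition torsion_free S : Prop :=
  forall x n, S x -> (0 < n)%N -> x *+ n = 0 -> x = 0.

Definition divisible S : Prop :=
  forall x n, S x -> (0 < n)%N -> exists2 y, S y & y *+ n = x.

Definition divisible_subgroup S D : Prop :=
  [/\ subgroup D, D `<=` S & divisible D].

Definition largest_divisible_subgroup S D : Prop :=
  divisible_subgroup S D /\ forall D', divisible_subgroup S D' -> D' `<=` D.

Definition reduced S : Prop := forall D, divisible_subgroup S D -> D = [set 0].

End AbelianGroups.

(* Main.v *)
Require Import Defs.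
From HB Require Import structures.
From mathcomp Require Import all_boot all_algebra.
From mathcomp Require Import boolp classical_sets functions.

(** Both parts are one theorem about a direct summand [N] of [G] stable under
    every endomorphism of [G], as the torsion part and the divisible part are
    (theorem [perspective_fully_invariant]).  Write [G = N (+) M] and let [pi]
    be the projection onto [M] along [N].

    A direct summand of a perspective group is perspective: enlarge the
    complements inside the summand by the other summand, find a common
    complement [C] in the large group, and cut [C] down by the modular law
    (lemma [perspective_summand]).

    For the converse let [G = A (+) H = B (+) K] with [A] isomorphic to [B].
    As [N] is stable under the projections, the decomposition splits into
    [N = (N & A) (+) (N & H)] and [M = pi(A) (+) pi(H)].  As [N] is stable
    under the extension by zero of the isomorphism and of its inverse, both
    restrict to [N & A], [N & B] and descend to [pi(A)], [pi(B)].  Perspectivity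
    of [N] and of [M] now gives a common complement [C] of [N & A] and [N & B]
    in [N], and a common complement [C'] of [pi(A)] and [pi(B)] in [M]; then
    [C + C'] is a common complement of [A] and [B] in [G] (lemma
    [complement_glue]). *)

Set Implicit Arguments.
Unset Strict Implicit.
Unset Printing Implicit Defensive.

Import GRing.Theory.
Local Open Scope ring_scope.
Local Open Scope classical_set_scope.

Section Perspectivity.
Context {G : zmodType}.
Implicit Types (S A B C H K M N : set G) (F E pi : {additive G -> G}).

(** * Subgroups, direct sums and isomorphisms *)

Lemma subgroupP S :
  subgroup S <-> S 0 /\ forall x y, S x -> S y -> S (x - y).
Proof.
split=> [[S0 SB]|[S0 SB]].
  split=> [|x y Sx Sy]; first exact: set_mem.
  by apply: set_mem; apply: SB; apply: mem_set.
by split=> [|x y /set_mem Sx /set_mem Sy]; apply: mem_set => //; apply: SB.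
Qed.

Lemma subgroup0 S : subgroup S -> S 0.
Proof. by case/subgroupP. Qed.

Lemma subgroupB S x y : subgroup S -> S x -> S y -> S (x - y).
Proof. by case/subgroupP => _; apply. Qed.

Lemma subgroupD S x y : subgroup S -> S x -> S y -> S (x + y).
Proof.
move=> sS Sx Sy; rewrite -[y]opprK -[- y]sub0r.
by apply: subgroupB => //; apply: subgroupB => //; apply: subgroup0.
Qed.

Lemma subgroupI A B : subgroup A -> subgroup B -> subgroup (A `&` B).
Proof.
move=> sA sB; apply/subgroupP; split=> [|x y [Ax Bx] [Ay By]].
  by split; apply: subgroup0.
by split; apply: subgroupB.
Qed.

Lemma subgroup_image F A : subgroup A -> subgroup (F @` A).
Proof.
move=> sA; apply/subgroupP; split=> [|_ _ [x Ax <-] [y Ay <-]].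
  by exists 0; [exact: subgroup0 | rewrite raddf0].
by exists (x - y); [exact: subgroupB | rewrite raddfB].
Qed.

Lemma subgroup_sum A B :
  subgroup A -> subgroup B -> subgroup [set a + b | a in A & b in B].
Proof.
move=> sA sB; apply/subgroupP; split.
  exists 0; first exact: subgroup0.
  by exists 0; [exact: subgroup0 | rewrite addr0].
move=> _ _ [a Aa [b Bb <-]] [a' Aa' [b' Bb' <-]].
exists (a - a'); first exact: subgroupB.
by exists (b - b'); [exact: subgroupB | rewrite addrACA opprD].
Qed.

Lemma direct_sum_intro S A H :
    subgroup S -> subgroup A -> subgroup H -> A `<=` S -> H `<=` S ->
    (forall x, S x -> exists a h, [/\ A a, H h & x = a + h]) ->
    (forall x, A x -> H x -> x = 0) ->
  direct_sum S A H.
Proof.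
move=> sS sA sH AS HS dec disj; split => //; apply/seteqP; split.
- by move=> _ [a Aa [h Hh <-]]; apply: subgroupD => //; [exact: AS | exact: HS].
- by move=> x /dec[a [h [Aa Hh ->]]]; exists a => //; exists h.
- by move=> x [Ax Hx]; apply: disj.
- by move=> _ ->; split; apply: subgroup0.
Qed.

Lemma direct_sum_elim S A H : direct_sum S A H ->
  [/\ subgroup S, A `<=` S, H `<=` S,
      forall x, S x -> exists a h, [/\ A a, H h & x = a + h] &
      forall x, A x -> H x -> x = 0].
Proof.
move=> [sA sH defS disj]; rewrite -defS; split.
- exact: subgroup_sum.
- by move=> a Aa; exists a => //; exists 0; [exact: subgroup0|rewrite addr0].
- move=> h Hh; exists 0; first exact: subgroup0.
  by exists h => //; rewrite add0r.
- by move=> _ [a Aa [h Hh <-]]; exists a, h.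
- by move=> x Ax Hx; have: (A `&` H) x by []; rewrite disj.
Qed.

Lemma direct_sumC S A H : direct_sum S A H -> direct_sum S H A.
Proof.
move=> dS; have [sA sH _ _] := dS.
have [sS AS HS dec disj] := direct_sum_elim dS.
apply: direct_sum_intro => // [x /dec[a [h [Aa Hh ->]]]|x Hx Ax].
  by exists h, a; rewrite addrC.
exact: disj.
Qed.

Lemma subgroupT : subgroup [set: G].
Proof. by apply/subgroupP. Qed.

Lemma direct_sum_proj A H : direct_sum [set: G] A H ->
  exists p : {additive G -> G},
    [/\ forall x, A (p x), forall x, H (x - p x),
        forall a, A a -> p a = a & forall h, H h -> p h = 0].
Proof.
move=> dG; have [sA sH _ _] := dG.
have [_ _ _ dec disj] := direct_sum_elim dG.
have /choice[p pP] : forall x, exists a, A a /\ H (x - a).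
  by move=> x; have [a [h [Aa Hh ->]]] := dec x I; exists a; rewrite addrC addKr.
(* The decomposition is unique, hence every identity about [p]. *)
have p_uniq x a : A a -> H (x - a) -> p x = a.
  move=> Aa Hxa; have [Apx Hpx] := pP x.
  apply/eqP; rewrite -subr_eq0; apply/eqP/disj; first exact: subgroupB.
  have -> : p x - a = (x - a) - (x - p x).
    by rewrite opprB [RHS]addrC addrA subrK.
  exact: subgroupB.
have p_add : zmod_morphism p.
  move=> x y; have [Ax Hx] := pP x; have [Ay Hy] := pP y.
  apply: p_uniq; first exact: subgroupB.
  have -> : x - y - (p x - p y) = (x - p x) - (y - p y).
    by rewrite !opprD !opprK addrACA.
  exact: subgroupB.
pose pA := HB.pack_for {additive G -> G} p
  (GRing.isZmodMorphism.Build G G p p_add).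
exists pA; split=> [x|x|a Aa|h Hh]; rewrite /=.
- by case: (pP x).
- by case: (pP x).
- by apply: p_uniq => //; rewrite subrr; apply: subgroup0.
- by apply: p_uniq; [exact: subgroup0 | rewrite subr0].
Qed.

Lemma isomorphic_intro F E A B :
    (forall a, A a -> B (F a)) -> (forall b, B b -> A (E b)) ->
    (forall a, A a -> E (F a) = a) -> (forall b, B b -> F (E b) = b) ->
  isomorphic A B.
Proof.
move=> FAB EBA FK EK; exists F; first by move=> x y _ _; exact: raddfD.
split=> [a Aa|x y /set_mem Ax /set_mem Ay eqF|b Bb]; first exact: FAB.
  by rewrite -[x]FK // eqF FK.
by exists (E b); [exact: EBA | exact: EK].
Qed.

(** Composing with the projection onto the domain extends a homomorphism
    defined on a direct summand by zero on the complement. *)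
Lemma additive_extension A H (f : G -> G) :
    direct_sum [set: G] A H -> {in A &, {morph f : x y / x + y}} ->
  exists F : {additive G -> G}, forall a, A a -> F a = f a.
Proof.
move=> dG fD; have [sA _ _ _] := dG.
have [p [Ap _ pA _]] := direct_sum_proj dG.
have fp_add : zmod_morphism (f \o p).
  move=> x y; apply/eqP; rewrite eq_sym subr_eq; apply/eqP.
  by rewrite /= -fD ?raddfB ?subrK //; apply: mem_set => //; exact: subgroupB.
pose F := HB.pack_for {additive G -> G} (f \o p)
  (GRing.isZmodMorphism.Build G G (f \o p) fp_add).
by exists F => a Aa; rewrite /= pA.
Qed.

(** Isomorphic direct summands are interchanged by endomorphisms of the whole
    group; in this form the isomorphism can be tested against fully invariant
    subgroups. *)
Lemma isomorphic_extension A H B K :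
    direct_sum [set: G] A H -> direct_sum [set: G] B K -> isomorphic A B ->
  exists F E : {additive G -> G},
    [/\ forall a, A a -> B (F a), forall b, B b -> A (E b),
        forall a, A a -> E (F a) = a & forall b, B b -> F (E b) = b].
Proof.
move=> dA dB [f fD [fAB finj fsurj]].
have [sA _ _ _] := dA; have [sB _ _ _] := dB.
have /choice[g gP] : forall b, exists a, B b -> A a /\ f a = b.
  move=> b; case: (pselect (B b)) => [/fsurj[a Aa fa]|nBb]; first by exists a.
  by exists 0.
have gA b : B b -> A (g b) by move=> /gP[].
have gK b : B b -> f (g b) = b by move=> /gP[].
have fK a : A a -> g (f a) = a.
  move=> Aa; have Bfa := fAB _ Aa.
  by apply: finj; rewrite ?inE ?gK //; exact: gA.
have gD : {in B &, {morph g : x y / x + y}}.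
  move=> x y /set_mem Bx /set_mem By; have Bxy := subgroupD sB Bx By.
  have [Ax Ay] := (gA _ Bx, gA _ By).
  apply: finj; rewrite ?inE; [exact: gA | exact: subgroupD |].
  by rewrite fD ?inE // !gK.
have [F Ff] := additive_extension dA fD.
have [E Eg] := additive_extension dB gD.
exists F, E; split=> [a Aa|b Bb|a Aa|b Bb].
- by rewrite Ff //; exact: fAB.
- by rewrite Eg //; exact: gA.
- by rewrite Ff // Eg; [exact: fK | exact: fAB].
- by rewrite Eg // Ff; [exact: gK | exact: gA].
Qed.

(** * Perspectivity passes to direct summands *)

Lemma direct_sum_enlarge N M A H :
    direct_sum [set: G] N M -> direct_sum N A H ->
  direct_sum [set: G] A [set h + m | h in H & m in M].
Proof.
move=> dG dN; have [sN sM _ _] := dG; have [sA sH _ _] := dN.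
have [_ _ _ decG disjG] := direct_sum_elim dG.
have [_ AN HN decN disjN] := direct_sum_elim dN.
apply: direct_sum_intro => //; first exact: subgroupT.
- exact: subgroup_sum.
- move=> x _; have [n [m [/decN[a [h [Aa Hh ->]]] Mm ->]]] := decG x I.
  exists a, (h + m); split => //; last by rewrite addrA.
  by exists h => //; exists m.
- move=> x Ax [h Hh [m Mm def_x]].
  have m0 : m = 0.
    apply: disjG => //; rewrite -[m](addKr h) def_x addrC.
    by apply: subgroupB => //; [exact: AN | exact: HN].
  by apply: disjN => //; rewrite -def_x m0 addr0.
Qed.

(** The modular law. *)
Lemma direct_sum_cut N A C :
    subgroup N -> A `<=` N -> direct_sum [set: G] A C ->
  direct_sum N A (C `&` N).
Proof.
move=> sN AN dG; have [sA sC _ _] := dG.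
have [_ _ _ dec disj] := direct_sum_elim dG.
apply: direct_sum_intro => //; first exact: subgroupI.
- move=> x Nx; have [a [c [Aa Cc def_x]]] := dec x I.
  exists a, c; split => //; split => //.
  by rewrite -[c](addKr a) -def_x addrC; apply: subgroupB => //; exact: AN.
- by move=> x Ax [Cx _]; apply: disj.
Qed.

Lemma perspective_summand N M :
  direct_sum [set: G] N M -> perspective [set: G] -> perspective N.
Proof.
move=> dG pG A H B K dA dB isoAB; have [sN _ _ _] := dG.
have [_ AN _ _ _] := direct_sum_elim dA.
have [_ BN _ _ _] := direct_sum_elim dB.
have [C [dAC dBC]] :=
  pG _ _ _ _ (direct_sum_enlarge dG dA) (direct_sum_enlarge dG dB) isoAB.
by exists (C `&` N); split; apply: direct_sum_cut.
Qed.

(** * Fully invariant summands *)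

Definition fully_invariant N : Prop := forall F x, N x -> N (F x).

Lemma fully_invariant_split N A H :
    subgroup N -> fully_invariant N -> direct_sum [set: G] A H ->
  direct_sum N (N `&` A) (N `&` H).
Proof.
move=> sN invN dG; have [sA sH _ _] := dG.
have [_ _ _ _ disj] := direct_sum_elim dG.
have [p [Ap Hp _ _]] := direct_sum_proj dG.
apply: direct_sum_intro; rewrite //; try exact: subgroupI.
- move=> x Nx; have Npx := invN p _ Nx.
  exists (p x), (x - p x); split; first by split.
    by split => //; exact: subgroupB.
  by rewrite addrC subrK.
- by move=> x [_ Ax] [_ Hx]; apply: disj.
Qed.

Section Projection.
(** [pi] is the projection onto [M] along [N]; it plays the role of the
    quotient map [G -> G / N]. *)
Variables (N M : set G) (pi : {additive G -> G}).
Hypothesis invN : fully_invariant N.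
Hypothesis dNM : direct_sum [set: G] N M.
Hypothesis piM : forall x, M (pi x).
Hypothesis piN : forall x, N (x - pi x).
Hypothesis pi_id : forall m, M m -> pi m = m.
Hypothesis pi_ker : forall n, N n -> pi n = 0.

Lemma pi_eq0 x : pi x = 0 -> N x.
Proof. by move=> pix0; have := piN x; rewrite pix0 subr0. Qed.

(** An endomorphism of [G] descends to the quotient by the fully invariant
    subgroup [N]. *)
Lemma pi_endo F x : pi (F (pi x)) = pi (F x).
Proof.
apply/eqP; rewrite eq_sym -subr_eq0 -!raddfB; apply/eqP/pi_ker.
exact: invN.
Qed.

(** Full invariance enters in the disjointness of the two images: if
    [pi a = pi h] then [a - h] lies in [N], hence so does its component [a]. *)
Lemma fully_invariant_quotient A H :
  direct_sum [set: G] A H -> direct_sum M (pi @` A) (pi @` H).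
Proof.
move=> dG; have [sA sH _ _] := dG; have [sN sM _ _] := dNM.
have [_ _ _ dec _] := direct_sum_elim dG.
have [p [_ _ pA pH]] := direct_sum_proj dG.
apply: direct_sum_intro; rewrite //; try exact: subgroup_image.
- by move=> _ [a _ <-].
- by move=> _ [h _ <-].
- move=> m Mm; have [a [h [Aa Hh def_m]]] := dec m I.
  exists (pi a), (pi h); split; [by exists a | by exists h |].
  by rewrite -raddfD -def_m pi_id.
- move=> _ [a Aa <-] [h Hh eq_pi]; apply: pi_ker.
  have Nah : N (a - h) by apply: pi_eq0; rewrite raddfB eq_pi subrr.
  by have := invN p Nah; rewrite raddfB pA // pH // subr0.
Qed.

(** To decompose [x], first match [pi x] in [M]; the error lies in [N], where
    [N & A] and [C] take over. *)
Lemma complement_glue A C C' :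
    subgroup A -> direct_sum N (N `&` A) C -> direct_sum M (pi @` A) C' ->
  direct_sum [set: G] A [set c + c' | c in C & c' in C'].
Proof.
move=> sA dN dM; have [_ sC _ _] := dN; have [_ sC' _ _] := dM.
have [_ _ CN decN disjN] := direct_sum_elim dN.
have [_ _ C'M decM disjM] := direct_sum_elim dM.
apply: direct_sum_intro => //; first exact: subgroupT.
- exact: subgroup_sum.
- move=> x _.
  have [_ [c' [[a Aa <-] C'c' pix]]] := decM _ (piM x).
  have : N (x - (a + c')).
    apply: pi_eq0.
    by rewrite raddfB raddfD /= pix (pi_id (C'M _ C'c')) subrr.
  move=> /decN[n [c [[Nn An] Cc def_x]]].
  exists (n + a), (c + c'); split; first exact: subgroupD.
    by exists c => //; exists c'.
  by rewrite addrACA -def_x subrK.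
- move=> x Ax [c Cc [c' C'c' def_x]].
  have pix : pi x = c'.
    by rewrite -def_x raddfD /= pi_ker ?add0r ?pi_id //; [exact: C'M | exact: CN].
  have c'0 : c' = 0 by apply: disjM => //; rewrite -pix; exists x.
  have xc : x = c by rewrite -def_x c'0 addr0.
  by apply: disjN; rewrite xc //; split; [exact: CN | rewrite -xc].
Qed.

Lemma perspective_glue :
  perspective N -> perspective M -> perspective [set: G].
Proof.
move=> pN pM A H B K dA dB isoAB.
have [sA _ _ _] := dA; have [sB _ _ _] := dB; have [sN _ _ _] := dNM.
have [F [E [FAB EBA FK EK]]] := isomorphic_extension dA dB isoAB.
have isoN : isomorphic (N `&` A) (N `&` B).
  apply: (@isomorphic_intro F E) => [x []|x []|x []|x []] Nx xP.
  - by split; [exact: invN | exact: FAB].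
  - by split; [exact: invN | exact: EBA].
  - exact: FK.
  - exact: EK.
have isoM : isomorphic (pi @` A) (pi @` B).
  apply: (@isomorphic_intro (pi \o F) (pi \o E)) => _ [x xP <-] /=.
  - by rewrite pi_endo; exists (F x) => //; exact: FAB.
  - by rewrite pi_endo; exists (E x) => //; exact: EBA.
  - by rewrite (pi_endo F) pi_endo FK.
  - by rewrite (pi_endo E) pi_endo EK.
have [C [dAC dBC]] := pN _ _ _ _ (fully_invariant_split sN invN dA)
  (fully_invariant_split sN invN dB) isoN.
have [C' [dAC' dBC']] := pM _ _ _ _ (fully_invariant_quotient dA)
  (fully_invariant_quotient dB) isoM.
by exists [set c + c' | c in C & c' in C']; split; apply: complement_glue.
Qed.

End Projection.

Theorem perspective_fully_invariant N M :
    fully_invariant N -> direct_sum [set: G] N M ->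
  perspective [set: G] <-> perspective N /\ perspective M.
Proof.
move=> invN dG; split=> [pG|[pN pM]].
  split; first exact: perspective_summand dG pG.
  exact: perspective_summand (direct_sumC dG) pG.
have [pi [piM piN pi_id pi_ker]] := direct_sum_proj (direct_sumC dG).
exact: perspective_glue pN pM.
Qed.

(** * The torsion part and the divisible part *)

Lemma torsion_part_fully_invariant : fully_invariant (torsion_part [set: G]).
Proof.
move=> F x [_ [n n_gt0 xn0]]; split => //.
by exists n => //; rewrite -raddfMn xn0 raddf0.
Qed.

(** The image of a divisible subgroup is divisible, hence lies in the largest
    one. *)
Lemma largest_divisible_fully_invariant D :
  largest_divisible_subgroup [set: G] D -> fully_invariant D.
Proof.
move=> [[sD _ divD] maxD] F x Dx; apply: (maxD (F @` D)); last by exists x.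
split=> [||_ n [y Dy <-] n_gt0] //; first exact: subgroup_image.
have [z Dz zn] := divD _ _ Dy n_gt0.
by exists (F z); [exists z | rewrite -raddfMn zn].
Qed.

End Perspectivity.

Theorem corollary3p5 (G : zmodType) :
  (forall F : set G,
     torsion_free F -> direct_sum [set: G] (torsion_part [set: G]) F ->
     (perspective [set: G] <->
      perspective (torsion_part [set: G]) /\ perspective F)) /\
  (forall D R : set G,
     largest_divisible_subgroup [set: G] D -> reduced R ->
     direct_sum [set: G] D R ->
     (perspective [set: G] <-> perspective D /\ perspective R)).
Proof.
split=> [F _ dG|D R maxD _ dG]; apply: perspective_fully_invariant => //.
  exact: torsion_part_fully_invariant.
exact: largest_divisible_fully_invariant.
Qed.
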